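(* Let $G$ be a minimally $2$-connected graph with $n$ vertices and $m$ edges. Then \[ ecvc(G)=cvc(G)=2n-m-1. \] Moreover, every minimum connected vertex cover of $G$ is an eternally winning configuration.
   Context: All graphs are finite and simple. A graph is $2$-connected if it has at least three vertices, is connected and has no cut vertex. It is minimally $2$-connected if it is $2$-connected and deleting any edge destroys $2$-connectivity. A vertex cover of a graph $G$ is a set of vertices meeting every edge; a connected vertex cover is a vertex cover that induces a connected subgraph. $cvc(G)$ is the minimum size of a connected vertex cover of $G$, and a minimum connected vertex cover is one of size $cvc(G)$. Eternal Connected Vertex Cover game with $k$ guards on a connected graph $G$ with at least one edge: the defender first chooses a set of $k$ vertices and places one guard on each; this set must be a connected vertex cover. In each round the attacker attacks an edge. The defender responds by moving guards simultaneously: each guard stays put or moves to a neighbouring vertex, at least one guard must move across the attacked edge (from one endpoint to the other; guards on both endpoints may exchange positions), and after the movement at most one guard occupies each vertex. The set of occupied vertices must be a connected vertex cover after every response; otherwise (or if no legal response exists) the attacker wins. $ecvc(G)$ is the least $k$ such that the defender with $k$ guards can defend every infinite sequence of attacks. A set $S$ of vertices is an eternally winning configuration if, starting with one guard on each vertex of $S$ (so $|S|$ guards), the defender can defend every infinite sequence of attacks. *)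

(* Defs.v *)
(* A finite simple graph is a symmetric irreflexive [e : rel T] on [T : finType];
   these two properties are hypotheses of the results, not of the definitions. *)
From mathcomp Require Import all_boot.
From mathcomp Require Import boolp.

Set Implicit Arguments.
Unset Strict Implicit.
Unset Printing Implicit Defensive.

Section Graph.
Variables (T : finType) (e : rel T).

Definition edges : {set {set T}} :=
  [set [set p.1; p.2] | p : T * T & e p.1 p.2].

Definition induced (S : {set T}) : rel T :=
  [rel x y | [&& x \in S, y \in S & e x y]].

Definition connected_in (S : {set T}) : bool :=
  [forall x in S, forall y in S, connect (induced S) x y].

Definition connected_graph : bool := connected_in [set: T].

(* Deleting [v] separates two vertices that were connected, i.e. increases the
   number of connected components. *)
Definition cut_vertex (v : T) : bool :=
  [exists x in [set~ v], exists y in [set~ v],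
     connect e x y && ~~ connect (induced [set~ v]) x y].

Definition two_connected : bool :=
  [&& 3 <= #|T|, connected_graph & [forall v, ~~ cut_vertex v]].

Definition delete_edge (A : {set T}) : rel T :=
  [rel x y | e x y && ([set x; y] != A)].

End Graph.

Definition minimally_two_connected (T : finType) (e : rel T) : bool :=
  two_connected e && [forall A in edges e, ~~ two_connected (delete_edge e A)].

Section ConnectedVertexCover.
Variables (T : finType) (e : rel T).

Definition vertex_cover (S : {set T}) : bool :=
  [forall x, forall y, e x y ==> (x \in S) || (y \in S)].

Definition connected_vertex_cover (S : {set T}) : bool :=
  vertex_cover S && connected_in e S.

(* The default [setT] is itself a connected vertex cover when the graph is
   connected, see [cvcP]. *)
Definition cvc : nat :=
  #|[arg min_(S < [set: T] | connected_vertex_cover S) #|S| ]|.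

Definition minimum_connected_vertex_cover (S : {set T}) : bool :=
  connected_vertex_cover S && (#|S| == cvc).

(* The guard initially at [u \in S] goes to [f u]; injectivity on [S] says that
   no vertex holds two guards afterwards.  As an edge [A] has two elements,
   [[set u; f u] = A] says that the guard at [u] crosses [A]. *)
Definition legal_response (S A S' : {set T}) : Prop :=
  exists f : T -> T,
    [/\ {in S &, injective f},
        {in S, forall u, f u = u \/ e u (f u)},
        f @: S = S',
        exists2 u, u \in S & [set u; f u] = A
      & connected_vertex_cover S'].

(* A strategy maps the list of attacks made so far to the set of occupied
   vertices, so responses cannot depend on future attacks.  In round [k], the
   attack is [a k] and [mkseq a k] is the list of the earlier ones. *)
Definition defends (sigma : seq {set T} -> {set T}) (a : nat -> {set T}) : Prop :=
  forall k, legal_response (sigma (mkseq a k)) (a k) (sigma (mkseq a k.+1)).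

Definition eternally_winning (S : {set T}) : Prop :=
  connected_vertex_cover S /\
  exists2 sigma : seq {set T} -> {set T}, sigma [::] = S &
    forall a : nat -> {set T}, (forall k, a k \in edges e) -> defends sigma a.

Definition defendable (k : nat) : Prop :=
  exists2 S : {set T}, #|S| = k & eternally_winning S.

(* At most one guard stands on each vertex, so only [k <= #|T|] matters; the
   default [#|T|] is defendable when the graph is connected, see [ecvcP]. *)
Definition ecvc : nat :=
  [arg min_(k < ord_max : 'I_#|T|.+1 | `[< defendable k >]) (k : nat)].

Lemma connected_vertex_coverT :
  connected_graph e -> connected_vertex_cover [set: T].
Proof.
by move=> ce; apply/andP; split=> //; apply/'forall_forallP=> x y; rewrite !inE implybT.
Qed.

Lemma cvcP : connected_graph e ->
  (exists2 S, connected_vertex_cover S & #|S| = cvc) /\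
  (forall S, connected_vertex_cover S -> cvc <= #|S|).
Proof.
move=> ce; rewrite /cvc; case: arg_minnP => [|S cS minS].
  exact: connected_vertex_coverT.
by split=> //; exists S.
Qed.

Lemma defendableT : symmetric e -> connected_graph e -> defendable #|T|.
Proof.
move=> se ce; have cT := connected_vertex_coverT ce.
exists [set: T]; first by rewrite cardsT.
split=> //; exists (fun=> [set: T]) => // a aE k.
have /imsetP[[x y] + /= defA] := aE k; rewrite inE /= => exy.
have fK : involutive (fun u => if u == x then y else if u == y then x else u).
  move=> u; case: (eqVneq u x) => [->|ux].
    by rewrite eqxx; case: eqVneq.
  case: (eqVneq u y) => [->|uy]; first by rewrite eqxx.
  by rewrite (negPf ux) (negPf uy).
exists (fun u => if u == x then y else if u == y then x else u); split=> //.
- by move=> u v _ _ /(can_inj fK).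
- move=> u _; case: eqVneq => [->|_]; first by right.
  by case: eqVneq => [->|_]; [right; rewrite se|left].
- apply/setP=> u; rewrite inE; apply/imsetP.
  by exists (if u == x then y else if u == y then x else u); rewrite ?fK.
- by exists x; rewrite ?inE ?eqxx.
Qed.

Lemma ecvcP : symmetric e -> connected_graph e ->
  defendable ecvc /\ (forall k, defendable k -> ecvc <= k).
Proof.
move=> se ce; rewrite /ecvc; case: arg_minnP => [|k /asboolP dk mink].
  by apply/asboolP; exact: defendableT.
split=> // j dj; have jT : j < #|T|.+1.
  by case: dj => S <- _; rewrite ltnS max_card.
by apply: (mink (Ordinal jT)); apply/asboolP.
Qed.

End ConnectedVertexCover.

(* Main.v *)
Require Import Defs.
From mathcomp Require Import all_boot all_order all_algebra.
From mathcomp Require Import perm boolp zify.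

Set Implicit Arguments.
Unset Strict Implicit.
Unset Printing Implicit Defensive.

(** The theorem rests on the vertices of degree two.

    _Degree-two vertices on cycles._  In a minimally 2-connected graph every
    cycle has at least two vertices of degree two ([another_degree2]).  Indeed,
    deleting an edge [xy] creates a cut vertex [w], so the remaining vertices
    split into a side [A] of [x] and a side of [y] joined by the edge [xy] only
    ([min2c_separation]).  Let [x'] be the other neighbour of [x] on the cycle
    and separate [x'x] by [w'].  If [w'] is in [A] or equal to [w], the side of
    [x'] lies strictly inside [A] ([separation_shrink]) and one continues there;
    otherwise [x] itself has degree two ([separation_degree2]).  So each of the
    two sides of [xy] contains a degree-two vertex of the cycle.

    _Exchange._  If a cycle lies inside a connected vertex cover [S], a
    degree-two vertex [w] of the cycle can be removed from [S]: its only two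
    neighbours are on the cycle, hence in [S], and remain connected along the
    rest of the cycle ([cover_setD1_cycle]).

    _The game._  Every connected vertex cover [S] is eternally winning
    ([cover_eternally_winning]).  An attack inside [S] is answered by a swap.  If [xy] is attacked
    with [x] in [S] and [y] outside, all neighbours of [y] are in [S]; close a
    path of [S] from [x] to another neighbour of [y] into a cycle through [y],
    choose on it [w] different from [y] of degree two, and shift the guards one
    step along the path from [w] through [x] to [y].  They then occupy
    [S + y - w], a connected vertex cover by the exchange property
    ([attack_response]).  Consequently [ecvc] and [cvc] agree.

    _The formula._  For a connected vertex cover [S] with independent complement
    [I], the graph induced on [S] has at least [|S| - 1] edges and each vertex of
    [I] accounts for at least two more, so [m >= |S| - 1 + 2 (n - |S|)]
    ([cover_lower_bound]).  Equality holds if [I] has only vertices of degree two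
    and [S] induces a tree.  Such an [S] exists ([tree_cover]): among the covers
    whose complement consists of degree-two vertices take a smallest one; a cycle
    in it would allow a further exchange step. *)

(** * Edges, connectivity and covers *)

Definition nbhd (T : finType) (e : rel T) (x : T) : {set T} := [set z | e x z].

Section Connectivity.
Variables (T : finType) (e : rel T).

Lemma mem_nbhd x y : (y \in nbhd e x) = e x y.
Proof. by rewrite inE. Qed.

Lemma edgesP (A : {set T}) :
  reflect (exists x y, e x y /\ A = [set x; y]) (A \in edges e).
Proof.
apply: (iffP imsetP) => [[[x y] exy ->] | [x [y [exy ->]]]].
  by exists x, y; split=> //; rewrite inE in exy.
by exists (x, y); rewrite ?inE.
Qed.

Lemma mem_edges x y : e x y -> [set x; y] \in edges e.
Proof. by move=> exy; apply/edgesP; exists x, y. Qed.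

Lemma connected_inP (S : {set T}) :
  reflect {in S &, forall x y, connect (induced e S) x y} (connected_in e S).
Proof.
apply: (iffP 'forall_implyP) => [cS x y xS yS | cS x xS].
  exact: (forall_inP (cS x xS)).
by apply/forall_inP=> y yS; apply: cS.
Qed.

Lemma connected_graphP :
  reflect (forall x y, connect e x y) (connected_graph e).
Proof.
have cT : connect (induced e [set: T]) =2 connect e.
  by apply: eq_connect => x y; rewrite /induced /= !inE.
apply: (iffP (connected_inP _)) => ce x y; first by rewrite -cT ce ?in_setT.
by rewrite cT.
Qed.

Lemma vertex_coverP (S : {set T}) :
  reflect (forall x y, e x y -> (x \in S) || (y \in S)) (vertex_cover e S).
Proof.
by apply: (iffP 'forall_forallP) => cS x y; move: (cS x y) => /implyP.
Qed.

Lemma induced_sym (S : {set T}) : symmetric e -> symmetric (induced e S).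
Proof. by move=> es x y; rewrite /induced /= es andbCA. Qed.

Lemma connect_stays (r : rel T) (X : {pred T}) x y :
    (forall u v, u \in X -> r u v -> v \in X) ->
  connect r x y -> x \in X -> y \in X.
Proof.
move=> rX /connectP[p + ->]; elim: p x => //= z p IHp x /andP[rxz pz] xX.
exact: IHp pz (rX _ _ xX rxz).
Qed.

Lemma connect_exit (r : rel T) (X : {pred T}) x y :
    connect r x y -> x \in X -> y \notin X ->
  exists a b, [/\ a \in X, b \notin X & r a b].
Proof.
move=> cxy xX yX; case: (boolP [exists a in X, exists b, (b \notin X) && r a b]).
  by case/exists_inP=> a aX /existsP[b /andP[bX rab]]; exists a, b.
move=> noexit; case/negP: yX; apply: connect_stays cxy xX => u v uX ruv.
apply: contraNT noexit => vX; apply/exists_inP; exists u => //.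
by apply/existsP; exists v; rewrite vX.
Qed.

Lemma path_connected_in (S : {set T}) x p :
    symmetric e -> path e x p -> {subset x :: p <= S} ->
  {in x :: p, forall y, connect (induced e S) x y}.
Proof.
move=> es; elim: p x => [|z p IHp] x /=.
  by move=> _ _ y /[!inE] /eqP->.
case/andP=> exz pz sS y /[!inE] /predU1P[-> // | yzp].
have sS' : {subset z :: p <= S} by move=> u uz; apply: sS; rewrite in_cons uz orbT.
apply: connect_trans (IHp _ pz sS' _ _); last by rewrite inE.
by apply: connect1; rewrite /induced /= exz !sS ?inE ?eqxx ?orbT.
Qed.

(** A walk of [S] through [w] enters and leaves it by neighbours of [w], so it
    is enough to reconnect these neighbours without [w]. *)
Lemma connected_in_setD1 (S : {set T}) w t :
    connected_in e S -> symmetric e -> t \in S -> t != w ->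
    {in S, forall v, e w v -> v != w -> connect (induced e (S :\ w)) t v} ->
  connected_in e (S :\ w).
Proof.
move=> /connected_inP cS es tS tw nw.
have ct v : v \in S -> v != w -> connect (induced e (S :\ w)) t v.
  move=> vS vw; pose X := [pred u | (u == w) || connect (induced e (S :\ w)) t u].
  have: v \in X.
    apply: connect_stays _ (cS _ _ tS vS) _; last by apply/orP; right; exact: connect0.
    move=> a b; rewrite /X !in_simpl /=.
    move=> aX /and3P[aS bS eab]; case: (eqVneq b w) => //= bw.
    case: (eqVneq a w) aX => [aw _ | aw /= cta]; first by rewrite nw // -aw.
    by apply: connect_trans cta (connect1 _); rewrite /induced /= !inE aw bw aS bS.
  by rewrite /X in_simpl /= (negPf vw).
apply/connected_inP=> u v /setD1P[uw uS] /setD1P[vw vS].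
apply: connect_trans (ct v vS vw).
by rewrite (sym_connect_sym (induced_sym _ es)) ct.
Qed.

End Connectivity.

(** * Two-connected graphs and edge separations *)

Section TwoConnected.
Variables (T : finType) (e : rel T).
Hypotheses (e_sym : symmetric e) (e_irr : irreflexive e).

Lemma two_connected_setC1 w s t :
  two_connected e -> s != w -> t != w -> connect (induced e [set~ w]) s t.
Proof.
case/and3P=> _ /connected_graphP ce /forallP/(_ w) ncut sw tw.
apply: contraNT ncut => ncst; apply/exists_inP; exists s; first by rewrite !inE.
by apply/exists_inP; exists t; rewrite ?inE // ce.
Qed.

(** The cut form of the absence of cut vertices: [w] alone never cuts [s]
    off from [t].  Every structural step below is an application of it to a
    suitable intersection of sides of separations. *)
Lemma two_connected_escape (X : {set T}) w s t :
    two_connected e -> s \in X -> w \notin X -> t \notin X -> t != w ->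
  exists a b, [/\ a \in X, b \notin X, b != w & e a b].
Proof.
move=> e2 sX wX tX tw; have sw : s != w by apply: contraNneq wX => <-.
have cst := two_connected_setC1 e2 sw tw.
have [a [b [aX bX /and3P[_ + eab]]]] := connect_exit cst sX tX.
by rewrite !inE => bw; exists a, b.
Qed.

Lemma two_connected_nbhd x y :
  two_connected e -> exists2 z, e x z & z != y.
Proof.
move=> e2; have T3 : 3 <= #|T| by case/and3P: e2.
have other (a b : T) : exists c, (c != a) && (c != b).
  have : 0 < #|~: [set a; b]|.
    by have := cardsC [set a; b]; rewrite cards2; lia.
  by case/card_gt0P=> c; rewrite !inE negb_or => ?; exists c.
wlog yx : y / y != x.
  move=> wl; case: (eqVneq y x) => [-> |]; last exact: wl.
  have [z /andP[zx _]] := other x x; have [u exu _] := wl z zx.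
  by exists u => //; apply: contraTneq exu => ->; rewrite e_irr.
have [t /andP[tx ty]] := other x y.
have [|||| a [b [/set1P-> _ bw eab]]] := @two_connected_escape [set x] y x t e2;
  rewrite ?inE //.
by exists b.
Qed.

Lemma card_nbhd_ge2 x : two_connected e -> 2 <= #|nbhd e x|.
Proof.
move=> e2; have [y exy _] := two_connected_nbhd x x e2.
have [z exz zy] := two_connected_nbhd x y e2.
rewrite (cardsD1 y) mem_nbhd exy (cardsD1 z) !inE zy exz; lia.
Qed.

(** [A] is one side of the mixed cut formed by the vertex [w] and the edge
    [xy], which is what the failure of 2-connectivity after the deletion of [xy]
    provides.  The other side is the complement of [w |: A]. *)
Record separation (A : {set T}) (w x y : T) : Prop := Separation {
  sep_x : x \in A;
  sep_w : w \notin A;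
  sep_y : y \notin A;
  sep_yw : y != w;
  sep_edge : e x y;
  sep_cross : forall a b, a \in A -> b \notin A -> e a b ->
    b = w \/ a = x /\ b = y }.

Lemma sep_crossr A w x y a b : separation A w x y ->
  a \in A -> b \notin A -> e b a -> b = w \/ a = x /\ b = y.
Proof. by move=> sA aA bA; rewrite e_sym; apply: sep_cross sA a b aA bA. Qed.

Lemma separation_sym A w x y :
  separation A w x y -> separation (~: (w |: A)) w y x.
Proof.
case=> xA wA yA yw exy cross; have xw : x != w by apply: contraNneq wA => <-.
split; rewrite ?inE ?eqxx ?xA ?orbT //; first by rewrite negb_or yw.
  by rewrite e_sym.
move=> a b; rewrite !inE !negb_or negb_and !negbK => /andP[aw aA].
case/predU1P=> [-> | bA eab]; first by left.
rewrite e_sym in eab; case: (cross b a bA aA eab); first by move/eqP: aw.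
by case=> -> ->; right.
Qed.

(** The graph without the edge [xy] stays 2-connected as long as every other
    vertex [w] leaves [x] and [y] connected: a path using the edge can be rerouted,
    and a [w] in [{x, y}] removes the edge anyway.  So minimality provides a [w]
    that separates [x] from [y], and [A] is the component of [x]. *)
Lemma min2c_separation x y :
  minimally_two_connected e -> e x y -> exists A w, separation A w x y.
Proof.
case/andP=> e2 /forall_inP minE exy; have /and3P[T3 /connected_graphP ce _] := e2.
pose e' := delete_edge e [set x; y].
pose e'' w := induced e' [set~ w].
have xy : x != y by apply: contraTneq exy => ->; rewrite e_irr.
have e'_sym : symmetric e' by move=> a b; rewrite /e' /delete_edge /= e_sym setUC.
have e'I a b : e a b -> (a = x /\ b = y) \/ (a = y /\ b = x) \/ e' a b.
  move=> eab; case: (eqVneq [set a; b] [set x; y]) => [ab|]; last first.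
    by move=> ab; right; right; rewrite /e' /delete_edge /= eab.
  have /set2P[ax|ay] : a \in [set x; y] by rewrite -ab set21.
    have : y \in [set a; b] by rewrite ab set22.
    rewrite ax => /set2P[yx|]; first by rewrite yx eqxx in xy.
    by left.
  have : x \in [set a; b] by rewrite ab set21.
  rewrite ay => /set2P[yx|]; first by rewrite yx eqxx in xy.
  by right; left.
(* Either some [w] separates [x] from [y], or deleting [xy] changes nothing. *)
case: (boolP [exists w, [&& w != x, w != y & ~~ connect (e'' w) x y]]).
  case/existsP=> w /and3P[wx wy nc].
  exists [set u | connect (e'' w) x u], w; split; rewrite ?in_set ?connect0 //.
  - apply/negP=> /(connect_stays (X := predC1 w)) /=.
    rewrite !inE eqxx eq_sym wx => /(_ _ isT) H.
    by apply: notF; apply: H => u v _ /and3P[_]; rewrite !inE.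
  - by rewrite eq_sym.
  move=> a b; rewrite !in_set => ca ncb eab.
  case: (eqVneq b w) => [-> | bw]; first by left.
  have aw : a != w.
    have := connect_stays (X := predC1 w) _ ca; rewrite !inE; apply.
      by move=> u v _ /and3P[_]; rewrite !inE.
    by rewrite eq_sym.
  case: (e'I _ _ eab) => [|[[ay _]|e'ab]]; first by right.
    by rewrite -ay ca in nc.
  by case/negP: ncb; apply: connect_trans ca (connect1 _);
    rewrite /e'' /induced /= !inE aw bw.
move=> allc.
have c'' w : w != x -> w != y -> connect (e'' w) x y.
  move=> wx wy; apply: contraNT allc => nc.
  by apply/existsP; exists w; rewrite wx wy.
case/negP: (minE [set x; y] (mem_edges exy)).
apply/and3P; split=> //.
  have cxy : connect e' x y.
    have [w /andP[wx wy]] : exists w, (w != x) && (w != y).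
      have : 0 < #|~: [set x; y]|.
        by have := cardsC [set x; y]; rewrite cards2; lia.
      by case/card_gt0P=> c; rewrite !inE negb_or => ?; exists c.
    have := c'' w wx wy; apply: connect_sub => a b /and3P[_ _].
    exact: connect1.
  apply/connected_graphP=> u v; have := ce u v.
  apply: connect_sub => a b /e'I[[-> ->]|[[-> ->]|e'ab]] //.
    by rewrite (sym_connect_sym e'_sym).
  exact: connect1.
apply/forallP=> w; apply/negP=> /exists_inP[s sw /exists_inP[t tw /andP[_ /negP[]]]].
rewrite !inE in sw tw.
have := two_connected_setC1 e2 sw tw; apply: connect_sub => a b /and3P[aw bw /e'I].
have sym'' := sym_connect_sym (induced_sym [set~ w] e'_sym).
case=> [[ax by_]|[[ay bx]|e'ab]].
- rewrite ax by_ in aw bw *; rewrite !inE in aw bw.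
  by apply: c''; rewrite eq_sym.
- rewrite ay bx in aw bw *; rewrite !inE in aw bw.
  by rewrite sym''; apply: c''; rewrite eq_sym.
- by apply: connect1; rewrite /induced /= aw bw.
Qed.

Lemma separation_neighbour A w x y z :
  separation A w x y -> e x z -> z != y -> z \in w |: A.
Proof.
move=> sA exz zy; rewrite !inE; case: (boolP (z \in A)); first by rewrite orbT.
move=> zA; case: (sep_cross sA (sep_x sA) zA exz) => [-> | [_ zy']].
  by rewrite eqxx.
by rewrite zy' eqxx in zy.
Qed.

(** The part of [P] beyond [w |: A] could be left only through [w], hence is
    empty; then [w] in [P] would have no neighbour beyond [A], and [x] would
    cut that side off. *)
Lemma separation_shrink A w x y P w' x' :
    two_connected e -> separation A w x y -> separation P w' x' x ->
    x' != y -> w' \in w |: A ->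
  P \proper A.
Proof.
move=> e2 sA sP x'y w'wA.
have x'wA : x' \in w |: A.
  by apply: separation_neighbour sA _ x'y; rewrite e_sym (sep_edge sP).
have [xA wA yA yw exy crossA] := sA; have [x'P w'P xP xw' _ crossP] := sP.
have xw : x != w by apply: contraNneq wA => <-.
have crossA' a b := @sep_crossr _ _ _ _ a b sA.
have crossP' a b := @sep_crossr _ _ _ _ a b sP.
(* A way out of the part of [P] beyond [w |: A] that avoids [w] either stays in
   [P] and enters [A], hence at [x], which is not in [P], or leaves [P] at [w']
   in [A], hence [w' = x], or is the edge [x'x], but [x'] is in [w |: A]:
   each case is absurd. *)
have PwA : P \subset w |: A.
  apply/subsetP=> p pP; apply: contraT => pwA.
  have pX : p \in P :\: (w |: A) by rewrite !inE -in_setU1 pwA.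
  have [||| a [b]] := @two_connected_escape _ w p x e2 pX; rewrite ?inE ?eqxx ?xA ?orbT //.
  rewrite -!in_setU1 => -[/andP[awA aP] bX bw eab].
  have [aw aA] : a != w /\ a \notin A.
    by apply/andP; rewrite -negb_or -in_setU1.
  have bA : b \in A -> b = x.
    move=> bA; case: (crossA' b a bA aA eab) => [aw' | []] //.
    by rewrite aw' eqxx in aw.
  case: (boolP (b \in P)) bX => [bP | bP _].
    rewrite andbT negbK => /setU1P[bw' | /bA bx]; first by rewrite bw' eqxx in bw.
    by rewrite -bx bP in xP.
  case: (crossP a b aP bP eab) => [bw' | [ax' _]]; last by rewrite ax' x'wA in awA.
  move: w'wA; rewrite -bw' => /setU1P[bw'' | /bA bx].
    by rewrite bw'' eqxx in bw.
  by rewrite -bw' bx eqxx in xw'.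
have wP : w \notin P.
  apply/negP=> wP.
  have w'A : w' \in A by case/setU1P: w'wA => // ww; rewrite ww wP in w'P.
  have yX : y \in ~: (w |: A) by rewrite !inE negb_or yw.
  have [||| a [b]] := @two_connected_escape _ x y w e2 yX.
  - by rewrite !inE xA orbT.
  - by rewrite !inE eqxx.
  - by rewrite eq_sym.
  rewrite !inE !negb_or => -[/andP[aw aA] + bx eab].
  rewrite negb_and !negbK => /predU1P[bw | bA]; last first.
    case: (crossA' b a bA aA eab) => [aw' | [bx' _]].
      by rewrite aw' eqxx in aw.
    by rewrite bx' eqxx in bx.
  have aP : a \notin P.
    by apply: contraNN aA => /(subsetP PwA); rewrite !inE (negPf aw).
  rewrite bw in eab; case: (crossP' w a wP aP eab) => [aw' | [_ ax]].
    by rewrite aw' w'A in aA.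
  by rewrite ax xA in aA.
apply/properP; split; last by exists x.
apply/subsetP=> p pP; case/setU1P: (subsetP PwA p pP) => // pw.
by rewrite -pw pP in wP.
Qed.

(** When [w'] is beyond [w |: A], the vertex [w] is on the side [P] of [x'],
    because the part of [P] in [A] must be left by a way other than [x].  The rest
    of [A] outside [P] is then attached through [x] only, so it is just [x], whose
    neighbours can only be [x'] and [y]. *)
Lemma separation_degree2 A w x y P w' x' :
    two_connected e -> separation A w x y -> separation P w' x' x ->
    x' != y -> w' \notin w |: A ->
  #|nbhd e x| = 2.
Proof.
move=> e2 sA sP x'y; rewrite !inE negb_or => /andP[w'w w'A].
have x'wA : x' \in w |: A.
  by apply: separation_neighbour sA _ x'y; rewrite e_sym (sep_edge sP).
have [xA wA yA yw exy crossA] := sA; have [x'P w'P xP xw' _ crossP] := sP.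
have xw : x != w by apply: contraNneq wA => <-.
have crossA' a b := @sep_crossr _ _ _ _ a b sA.
have crossP' a b := @sep_crossr _ _ _ _ a b sP.
have wP : w \in P.
  case/setU1P: x'wA => [<- // | x'A].
  have x'X : x' \in P :&: A by rewrite inE x'P.
  have [||| a [b]] := @two_connected_escape _ x x' w e2 x'X.
  - by rewrite inE (negPf xP).
  - by rewrite inE (negPf wA) andbF.
  - by rewrite eq_sym.
  rewrite !inE => -[/andP[aP aA] + bx eab].
  have ax : a != x by apply: contraNneq xP => <-.
  have bA : b \notin A -> b = w.
    by move=> bA; case: (crossA a b aA bA eab) => // -[ax']; rewrite ax' eqxx in ax.
  case: (boolP (b \in P)) => [bP /bA <- // | bP _].
  case: (crossP a b aP bP eab) => [bw' | [_ bx']]; last by rewrite bx' eqxx in bx.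
  by move: bA w'w; rewrite bw' => -> //; rewrite eqxx.
have crossP'' a b : b \in P -> a \notin P -> a \in A -> a != x -> e a b -> False.
  move=> bP aP aA ax eab; case: (crossP' b a bP aP eab) => [aw'|[_ ax']].
    by rewrite -aw' aA in w'A.
  by rewrite ax' eqxx in ax.
(* The vertices of [A] outside [P] other than [x] would be cut off by [x]. *)
have AP q : q \in A -> q != x -> q \in P.
  move=> qA qx; apply: contraT => qP.
  have qX : q \in (A :\: P) :\ x by rewrite !inE qx qP.
  have [||| a [b]] := @two_connected_escape _ x q y e2 qX.
  - by rewrite !inE eqxx.
  - by rewrite !inE (negPf yA) !andbF.
  - by apply: contraNneq yA => ->.
  rewrite !inE => -[/and3P[ax aP aA] + bx eab]; rewrite bx /=.
  case: (boolP (b \in P)) => [bP | bP /= bA].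
    by case: (crossP'' a b).
  case: (crossA a b aA bA eab) => [bw | [ax' _]]; last by rewrite ax' eqxx in ax.
  by rewrite bw wP in bP.
apply/eqP; rewrite eqn_leq card_nbhd_ge2 // andbT.
apply: (@leq_trans #|[set x'; y]|); last by rewrite cards2; case: eqP.
apply/subset_leq_card/subsetP=> z; rewrite mem_nbhd => exz.
have zx : z != x by apply: contraTneq exz => ->; rewrite e_irr.
have zP : z \in P -> z = x'.
  move=> zP; case: (crossP' z x zP xP exz) => [xw'' | [-> //]].
  by rewrite -xw'' eqxx in xw'.
case: (boolP (z \in A)) => [zA | zA]; first by rewrite zP ?AP // set21.
case: (crossA x z xA zA exz) => [zw | [_ ->]]; last exact: set22.
by rewrite zP ?set21 // zw.
Qed.

(** The vertex set of a cycle has this property, and it is the form in which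
    the descent uses cycles: from a vertex reached along an edge, it moves on to
    another neighbour in [C]. *)
Definition min_degree2_in (C : {set T}) : Prop :=
  forall x y, x \in C -> exists2 z, z \in C & e x z /\ z != y.

(** Descent on [A]: either [x] has degree two, or the separation of the edge
    to the next vertex of [C] has a strictly smaller side. *)
Lemma separation_has_degree2 (C A : {set T}) w x y :
    minimally_two_connected e -> min_degree2_in C ->
    x \in C -> separation A w x y ->
  exists v, [/\ v \in C, v \in A & #|nbhd e v| = 2].
Proof.
move=> e_min C2; have e2 : two_connected e by case/andP: e_min.
have [n] := ubnP #|A|; elim: n => // n IHn in A w x y *.
rewrite ltnS => leAn xC sA; have [x' x'C [exx' x'y]] := C2 x y xC.
have [P [w' sP]] : exists P w', separation P w' x' x.
  by apply: min2c_separation; rewrite // e_sym.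
case: (boolP (w' \in w |: A)) => [w'A | w'A].
  have PA := separation_shrink e2 sA sP x'y w'A.
  have [|v [vC vP v2]] := IHn P w' x' x _ x'C sP.
    exact: leq_trans (proper_card PA) leAn.
  by exists v; split=> //; apply: (subsetP (proper_sub PA)).
by exists x; split; rewrite ?(sep_x sA) //; apply: separation_degree2 sP x'y w'A.
Qed.

(** Both sides of a separation contain a degree-two vertex of [C]; the one
    found in the side avoiding [t] differs from [t]. *)
Lemma another_degree2 (C : {set T}) x t :
    minimally_two_connected e -> min_degree2_in C -> x \in C ->
  exists v, [/\ v \in C, v != t & #|nbhd e v| = 2].
Proof.
move=> e_min C2 xC; have [y yC [exy _]] := C2 x x xC.
have [A [w sA]] := min2c_separation e_min exy.
case: (boolP (t \in A)) => tA; last first.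
  have [v [vC vA v2]] := separation_has_degree2 e_min C2 xC sA.
  by exists v; split=> //; apply: contraNneq tA => <-.
have [v [vC vA v2]] := separation_has_degree2 e_min C2 yC (separation_sym sA).
exists v; split=> //; apply: contraTneq vA => ->.
by rewrite !inE tA orbT.
Qed.

End TwoConnected.

(** * Removing a degree-two vertex of a cycle from a cover *)

Section Cycles.
Variables (T : finType) (e : rel T).
Hypotheses (e_sym : symmetric e) (e_irr : irreflexive e).

(** Rotating [w] to the front exposes its two neighbours on the cycle and the
    path that joins them without passing through [w]. *)
Lemma cycle_rotate (c : seq T) w :
    uniq c -> cycle e c -> 2 < size c -> w \in c ->
  exists a q b, [/\ uniq [:: w, a & rcons q b], path e a (rcons q b),
    e w a, e w b & [:: w, a & rcons q b] =i c].
Proof.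
move=> uc cyc c3 /rot_to[i c' defc].
move: uc cyc c3 (mem_rot i c); rewrite -(rot_uniq i) -(rot_cycle i) -(size_rot i).
rewrite defc; case: c' {defc} => [|a c'] // uc.
case: (lastP c') uc => // q b uc cyc _ eqc.
exists a, q, b; move: cyc; rewrite /= rcons_path last_rcons => /and3P[ewa pq ebw].
by split; rewrite // e_sym.
Qed.

Lemma cycle_min_degree2 (c : seq T) :
  uniq c -> cycle e c -> 2 < size c -> min_degree2_in e [set u in c].
Proof.
move=> uc cyc c3 x y; rewrite inE => xc.
have [a [q [b [/and3P[_ aq _] _ exa exb eqc]]]] := cycle_rotate uc cyc c3 xc.
case: (eqVneq a y) => [<-|ay].
  exists b; first by rewrite inE -eqc !inE mem_rcons inE eqxx !orbT.
  by split=> //; apply: contraNneq aq => <-; rewrite mem_rcons inE eqxx.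
by exists a => //; rewrite inE -eqc !inE eqxx orbT.
Qed.

(** The neighbours of [w] are its two neighbours on the cycle: they are in the
    cover, so all edges at [w] stay covered, and the rest of the cycle connects
    them. *)
Lemma cover_setD1_cycle (S : {set T}) c w :
    connected_vertex_cover e S -> uniq c -> cycle e c -> 2 < size c ->
    {subset c <= S} -> w \in c -> #|nbhd e w| = 2 ->
  connected_vertex_cover e (S :\ w).
Proof.
move=> /andP[/vertex_coverP cov conS] uc cyc c3 cS wc w2.
have [a [q [b [ucw pab ewa ewb eqc]]]] := cycle_rotate uc cyc c3 wc.
have sub : {subset a :: rcons q b <= S :\ w}.
  move=> u uq; rewrite !inE cS ?andbT; last by rewrite -eqc in_cons uq orbT.
  by apply: contraTneq uq => ->; case/andP: ucw.
have ab : a != b.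
  case/and3P: ucw => _ + _; apply: contraNneq => ->.
  by rewrite mem_rcons inE eqxx.
have bq : b \in a :: rcons q b by rewrite inE mem_rcons inE eqxx orbT.
have nbw : nbhd e w = [set a; b].
  apply/esym/eqP; rewrite eqEcard w2 cards2 ab andbT.
  by apply/subsetP=> z /set2P[]->; rewrite mem_nbhd.
have aS := sub a (mem_head _ _); have bS := sub b bq.
have cab := path_connected_in e_sym pab sub.
apply/andP; split.
  have nw v : e w v -> v \in S :\ w.
    by rewrite -mem_nbhd nbw => /set2P[]->.
  apply/vertex_coverP=> u v euv.
  case: (eqVneq u w) euv => [-> /nw-> | uw euv]; first by rewrite orbT.
  case: (eqVneq v w) euv => [-> | vw euv]; first by rewrite e_sym => /nw->.
  by rewrite !inE uw vw cov.
case/setD1P: aS => aw aS; apply: connected_in_setD1 aw _ => // v vS.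
rewrite -mem_nbhd nbw => /set2P[]-> // _.
exact: cab.
Qed.

End Cycles.

(** * Answering the attacks *)

Section Game.
Variables (T : finType) (e : rel T).
Hypotheses (e_sym : symmetric e) (e_irr : irreflexive e).

Lemma prev_path (y : T) (p : seq T) : path e y p -> uniq (y :: p) ->
  {in p, forall u, e u (prev (y :: p) u)}.
Proof.
move=> yp uyp u up; rewrite e_sym prev_nth in_cons up orbT.
have := pathP y yp (index u p); rewrite index_mem nth_index // => /(_ up).
by [].
Qed.

Lemma prev_head (y : T) (p : seq T) : uniq (y :: p) -> prev (y :: p) y = last y p.
Proof.
case/andP=> yp _; rewrite prev_nth mem_head memNindex //.
exact: (nth_last y (y :: p)).
Qed.

(** Each guard of the path steps to its predecessor, so the one on [x] crosses
    to [y] and the last vertex is vacated.  The movement is realised by [prev] on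
    the closed sequence [y :: x :: p]: this permutation also sends [y] to the last
    vertex, but no guard stands on [y].  Thus injectivity and the image come for
    free. *)
Lemma shift_response (S : {set T}) y x p :
    y \notin S -> path e y (x :: p) -> uniq (y :: x :: p) ->
    {subset x :: p <= S} ->
    connected_vertex_cover e ((y |: S) :\ last x p) ->
  legal_response e S [set x; y] ((y |: S) :\ last x p).
Proof.
move=> yS yp uyp pS cov; set c := y :: x :: p.
have f_inj : injective (prev c) := can_inj (next_prev uyp).
have fy : prev c y = last x p by rewrite prev_head.
have xc : x \in x :: p by exact: mem_head.
have fS u : u \in S -> prev c u = u \/ e u (prev c u).
  move=> uS; case: (boolP (u \in x :: p)) => up; first by right; apply: prev_path.
  left; rewrite /c prev_nth in_cons (negPf up) orbF.
  by case: eqVneq => // uy; rewrite -uy uS in yS.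
exists (prev c); split=> //.
- by move=> u v _ _ /f_inj.
- apply/eqP; rewrite eqEcard card_imset //; apply/andP; split.
    apply/subsetP=> _ /imsetP[u uS ->]; rewrite in_setD1 -fy (inj_eq f_inj).
    rewrite (contraNneq _ yS) => [|<- //]; rewrite andTb.
    case: (boolP (u \in c)) => uc; last first.
      by rewrite /c prev_nth (negPf uc) in_setU1 uS orbT.
    by rewrite -mem_prev in uc; case/predU1P: uc => [->|/pS pu]; rewrite in_setU1 ?eqxx ?pu ?orbT.
  have := cardsD1 (last x p) (y |: S); rewrite cardsU1 yS.
  by rewrite in_setU1 pS ?mem_last // orbT !add1n => -[->].
- exists x; first exact: pS.
  by rewrite /c prev_nth in_cons xc orbT /= eqxx.
Qed.

Lemma swap_response (S : {set T}) x y :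
    e x y -> x \in S -> y \in S -> connected_vertex_cover e S ->
  legal_response e S [set x; y] S.
Proof.
move=> exy xS yS cov; exists (tperm x y); split=> //.
- by move=> u v _ _ /perm_inj.
- move=> u _; case: tpermP => [->|->|]; [right|right|left] => //.
  by rewrite e_sym.
- apply/eqP; rewrite eqEcard card_imset ?leqnn ?andbT; last exact: perm_inj.
  by apply/subsetP=> _ /imsetP[u uS ->]; case: tpermP.
- by exists x; rewrite ?tpermL.
Qed.

(** An edge inside [S] is answered by a swap.  If [y] is outside [S], a path of
    [S] between two neighbours of [y] closes into a cycle, and the guards move along
    it from a degree-two vertex [w] towards [y]. *)
Lemma attack_response (S A : {set T}) :
    minimally_two_connected e -> connected_vertex_cover e S -> A \in edges e ->
  exists S', legal_response e S A S'.
Proof.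
move=> e_min cov /edgesP[x [y [exy ->]]].
wlog xS : x y exy / x \in S => [wl|].
  case/andP: (cov) => /vertex_coverP/(_ x y exy)/orP[xS|yS] _; first exact: wl exy xS.
  by rewrite setUC; apply: wl yS; rewrite e_sym.
case: (boolP (y \in S)) => yS.
  by exists S; apply: swap_response.
have e2 : two_connected e by case/andP: e_min.
have [/vertex_coverP vc /connected_inP conS] := andP cov.
have nyS u : e y u -> u \in S by move/vc; rewrite (negPf yS).
have [z eyz zx] := two_connected_nbhd e_irr y x e2.
have /connectP[p0 xp0 defz] := conS _ _ xS (nyS z eyz).
case: (shortenP xp0) defz => p xp up _ defz.
have pS : {subset x :: p <= S}.
  have all_p : all (mem S) p.
    by elim: p (x) xp {up defz} => //= v p IHp u /andP[/and3P[_ -> _] /IHp].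
  by move=> u /predU1P[-> //|]; apply: allP all_p u.
have yx : e y x by rewrite e_sym.
pose c := y :: x :: p.
have uc : uniq c.
  by rewrite /c cons_uniq up andbT; apply: contra yS; apply: pS.
have path_p : path e x p by apply: sub_path xp => u v /and3P[].
have cyc : cycle e c.
  by rewrite /c /= yx rcons_path path_p -defz e_sym.
have c3 : 2 < size c.
  by rewrite /c; case: (p) defz => //= zx'; rewrite zx' eqxx in zx.
have cS : {subset c <= y |: S}.
  by move=> u /predU1P[->|/pS]; rewrite in_setU1 ?eqxx // => ->; rewrite orbT.
(* The exchange is made inside [S + y], which contains the whole cycle. *)
have covy : connected_vertex_cover e (y |: S).
  apply/andP; split.
    apply/vertex_coverP=> u v /vc/orP[]; rewrite !in_setU1 => ->;
      by rewrite !orbT.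
  pose r := induced e (y |: S).
  have r_sym : connect_sym r by apply/sym_connect_sym/induced_sym.
  have cx u : u \in y |: S -> connect r x u.
    case/setU1P => [->|uS].
      by apply: connect1; rewrite /r /induced /= !in_setU1 xS eqxx orbT.
    apply: connect_sub (conS x u xS uS) => a b /and3P[aS bS eab].
    by apply: connect1; rewrite /r /induced /= !in_setU1 aS bS !orbT.
  apply/connected_inP=> u v uS vS; apply: connect_trans (cx v vS).
  by rewrite -/r r_sym cx.
have xc : x \in [set u in c] by rewrite !inE eqxx orbT.
(* The second degree-two vertex matters here: [y] has to receive a guard. *)
have [w [wc wy w2]] := another_degree2 e_sym e_irr y e_min
  (cycle_min_degree2 e_sym uc cyc c3) xc.
rewrite inE in wc.
have covw := cover_setD1_cycle e_sym covy uc cyc c3 cS wc w2.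
have wxp : w \in x :: p by move: wc; rewrite inE (negPf wy).
exists ((y |: S) :\ w).
have [q [xq uq sq defw]] : exists q, [/\ path e x q, uniq (x :: q),
    {subset x :: q <= x :: p} & w = last x q].
  case/splitPl: wxp path_p up => p1 p2 <-.
  rewrite cat_path -cat_cons cat_uniq => /andP[xp1 _] /and3P[up1 _ _].
  by exists p1; split=> // u; rewrite mem_cat => ->.
rewrite defw in covw *; apply: shift_response => //.
- by rewrite /= yx.
- by rewrite cons_uniq uq andbT; apply: contra yS => /sq/pS.
- by move=> u /sq/pS.
Qed.

Lemma cover_eternally_winning (S : {set T}) :
    minimally_two_connected e -> connected_vertex_cover e S ->
  eternally_winning e S.
Proof.
move=> e_min cov.
have /choice[next nextP] (SA : {set T} * {set T}) : exists S',
    connected_vertex_cover e SA.1 -> SA.2 \in edges e ->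
  legal_response e SA.1 SA.2 S'.
  case: SA => S' A /=.
  case: (boolP (connected_vertex_cover e S')) => [covS | _]; last by exists S'.
  case: (boolP (A \in edges e)) => [AE | _]; last by exists S'.
  by have [S'' ?] := attack_response e_min covS AE; exists S''.
split=> //; pose sigma := foldl (fun S' A => next (S', A)) S.
exists sigma => // a aE.
have sigmaS k : sigma (mkseq a k.+1) = next (sigma (mkseq a k), a k).
  by rewrite /sigma mkseqS foldl_rcons.
have covs k : connected_vertex_cover e (sigma (mkseq a k)).
  elim: k => // k IHk; rewrite sigmaS.
  by case: (nextP (_, a k) IHk (aE k)) => f [].
by move=> k; rewrite sigmaS; exact: nextP (_, a k) (covs k) (aE k).
Qed.

Lemma ecvc_eq_cvc : minimally_two_connected e -> ecvc e = cvc e.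
Proof.
move=> e_min; have ce : connected_graph e by case/andP: e_min => /and3P[].
have [dk mink] := ecvcP e_sym ce; have [[S cov cardS] minS] := cvcP ce.
apply/eqP; rewrite eqn_leq mink; last first.
  by exists S => //; apply: cover_eternally_winning.
by case: dk => S' <- [cov' _]; apply: minS.
Qed.

End Game.

(** * Counting the edges *)

Section Counting.
Variables (T : finType) (e : rel T).
Hypotheses (e_sym : symmetric e) (e_irr : irreflexive e).

Definition inner_edges (S : {set T}) : {set {set T}} :=
  [set A in edges e | A \subset S].

Lemma mem_edgesE x y : ([set x; y] \in edges e) = e x y.
Proof.
apply/idP/idP; last exact: mem_edges.
case/edgesP=> a [b [eab xy]].
have aPb : a != b by apply: contraTneq eab => ->; rewrite e_irr.
have : a \in [set x; y] by rewrite xy set21.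
have : b \in [set x; y] by rewrite xy set22.
by do 2![case/set2P=> ?]; subst a b; rewrite ?eqxx // 1?e_sym in aPb *.
Qed.

Lemma mem_inner_edges S x y :
  ([set x; y] \in inner_edges S) = [&& e x y, x \in S & y \in S].
Proof. by rewrite inE mem_edgesE subUset !sub1set. Qed.

(** Breadth-first search: [d] is the distance to [r] inside [S], and [p v] is
    the last but one vertex of a shortest walk from [r] to [v]. *)
Lemma parent_function (S : {set T}) r : connected_in e S -> r \in S ->
  exists (p : T -> T) (d : T -> nat), {in S, forall v, v != r ->
    [/\ p v \in S, e v (p v) & d (p v) < d v]}.
Proof.
move=> /connected_inP conS rS.
pose walk v n := exists t, [/\ path (induced e S) r t, last r t = v & size t = n].
have walk_ex v : exists n, (v \in S) ==> `[< walk v n >].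
  case: (boolP (v \in S)) => [vS | _]; last by exists 0.
  have /connectP[t rt ->] := conS r v rS vS.
  by exists (size t); apply/asboolP; exists t.
pose d v := ex_minn (walk_ex v).
have walk_d v : v \in S -> walk v (d v).
  by move=> vS; rewrite /d; case: ex_minnP => n; rewrite vS => /asboolP.
have d_min v n : walk v n -> d v <= n.
  move=> vn; rewrite /d; case: ex_minnP => m _; apply.
  by apply/implyP=> _; apply/asboolP.
have /choice[p pP] (v : T) : exists u, v \in S -> v != r ->
    [/\ u \in S, e v u & d u < d v].
  case: (boolP (v \in S)) => [vS | _]; last by exists v.
  have [t [+ tv td]] := walk_d v vS.
  case: (lastP t) tv td => [<- _ _|q u]; first by exists v; rewrite eqxx.
  rewrite last_rcons size_rcons rcons_path => -> <- /andP[rq /and3P[lS _ elv]].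
  exists (last r q) => _ _; split; rewrite 1?e_sym // ltnS.
  by apply: d_min; exists q.
by exists p, d => v; apply: pP.
Qed.

(** The edges from a vertex to its parent are pairwise distinct because the
    distance to the root strictly decreases along them. *)
Lemma spanning_tree (S : {set T}) r : connected_in e S -> r \in S ->
  exists F : {set {set T}}, [/\ F \subset inner_edges S, #|F|.+1 = #|S|
    & {in S &, forall x y, connect (fun u v => [set u; v] \in F) x y}].
Proof.
move=> conS rS; have [p [d pd]] := parent_function conS rS.
pose F := [set [set v; p v] | v in S :\ r].
have F_sym : symmetric (fun u v => [set u; v] \in F) by move=> u v; rewrite setUC.
exists F; split.
- apply/subsetP=> _ /imsetP[v /setD1P[vr vS] ->].
  by have [pS epv _] := pd v vS vr; rewrite mem_inner_edges epv vS.
- rewrite card_in_imset; first by rewrite (cardsD1 r S) rS.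
  move=> u v /setD1P[ur uS] /setD1P[vr vS] uv.
  have [_ _ du] := pd u uS ur; have [_ _ dv] := pd v vS vr.
  have : u \in [set v; p v] by rewrite -uv set21.
  case/set2P=> // upv; have : v \in [set u; p u] by rewrite uv set21.
  case/set2P=> // vpu; rewrite -vpu in du; rewrite -upv in dv; lia.
have toroot v : v \in S -> connect (fun u v => [set u; v] \in F) v r.
  have [n] := ubnP (d v); elim: n v => // n IHn v; rewrite ltnS => dvn vS.
  case: (eqVneq v r) => [-> | vr]; first exact: connect0.
  have [pS _ dp] := pd v vS vr.
  apply: connect_trans (connect1 _) (IHn (p v) (leq_trans dp dvn) pS).
  by apply/imsetP; exists v; rewrite // !inE vr.
move=> x y xS yS; apply: connect_trans (toroot x xS) _.
by rewrite (sym_connect_sym F_sym) toroot.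
Qed.

(** The complement of a vertex cover is independent, so an edge not inside [S]
    has exactly one end outside [S] and is counted once. *)
Lemma card_outer_edges (S : {set T}) : vertex_cover e S ->
  #|edges e :\: inner_edges S| = \sum_(y in ~: S) #|nbhd e y|.
Proof.
move/vertex_coverP=> cov; pose P := [set p : T * T | (p.1 \notin S) && e p.1 p.2].
have covP y z : (y, z) \in P -> y \notin S /\ z \in S.
  by rewrite inE /= => /andP[yS /cov]; rewrite (negPf yS).
have -> : edges e :\: inner_edges S = [set [set p.1; p.2] | p in P].
  apply/setP=> A; apply/setDP/imsetP => [[/edgesP[x [y [exy ->]]]] | [[y z] yzP ->]].
    rewrite mem_inner_edges exy andTb negb_and => /orP[xS|yS].
      by exists (x, y); rewrite // inE xS.
    by exists (y, x); rewrite 1?setUC // inE /= yS e_sym.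
  have [yS _] := covP y z yzP; rewrite mem_inner_edges (negPf yS) andbF.
  by split=> //; apply: mem_edges; move: yzP; rewrite inE => /andP[].
rewrite card_in_imset => [|[y z] [y' z'] /covP[yS zS] /covP[y'S z'S] /= yz].
  under eq_bigr => y do rewrite -sum1_card.
  rewrite pair_big_dep /= -sum1_card; apply: eq_bigl => -[y z].
  by rewrite !inE.
have /set2P[yy'|yz'] : y \in [set y'; z'] by rewrite -yz set21.
  have /set2P[zy'|->] : z \in [set y'; z'] by rewrite -yz set22.
    by rewrite -zy' zS in y'S.
  by rewrite yy'.
by rewrite yz' z'S in yS.
Qed.

Lemma card_edges_split (S : {set T}) : vertex_cover e S ->
  #|edges e| = #|inner_edges S| + \sum_(y in ~: S) #|nbhd e y|.
Proof.
move=> cov; rewrite -card_outer_edges // -(cardsID (inner_edges S) (edges e)).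
by congr (#|pred_of_set _| + _); apply/setP=> A; rewrite !inE andbA andbb.
Qed.

Lemma cover_nonempty (S : {set T}) :
  two_connected e -> connected_vertex_cover e S -> exists r, r \in S.
Proof.
move=> e2 /andP[/vertex_coverP cov _].
have /card_gt0P[x _] : 0 < #|T| by case/and3P: e2 => /(leq_trans _)->.
have [y exy _] := two_connected_nbhd e_irr x x e2.
by case/orP: (cov x y exy); [exists x | exists y].
Qed.

Lemma cover_lower_bound (S : {set T}) :
  two_connected e -> connected_vertex_cover e S ->
  2 * #|T| <= #|S| + #|edges e| + 1.
Proof.
move=> e2 covS; have [r rS] := cover_nonempty e2 covS.
have /andP[cov conS] := covS.
have [F [/subset_leq_card FS cardF _]] := spanning_tree conS rS.
have : \sum_(y in ~: S) 2 <= \sum_(y in ~: S) #|nbhd e y|.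
  by apply: leq_sum => y _; apply: card_nbhd_ge2.
rewrite sum_nat_const (card_edges_split cov) -(cardsC S); lia.
Qed.

(** A smallest cover whose complement has only degree-two vertices induces a
    tree: an edge outside a spanning tree closes a cycle, on which a degree-two
    vertex could be discarded, giving a smaller such cover. *)
Lemma tree_cover : minimally_two_connected e ->
  exists S, [/\ connected_vertex_cover e S,
    forall v, v \notin S -> #|nbhd e v| = 2 & #|inner_edges S| < #|S|].
Proof.
move=> e_min; have e2 : two_connected e by case/andP: e_min.
pose good S := connected_vertex_cover e S && [forall v in ~: S, #|nbhd e v| == 2].
have goodT : good [set: T].
  rewrite /good connected_vertex_coverT; last by case/and3P: e2.
  by apply/forall_inP=> v; rewrite !inE.
case: (arg_minnP (fun S : {set T} => #|S|) goodT) => S /andP[covS degS] minS.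
have [r rS] := cover_nonempty e2 covS; have /andP[_ conS] := covS.
have [F [FS cardF conF]] := spanning_tree conS rS.
have FP u v : [set u; v] \in F -> [&& e u v, u \in S & v \in S].
  by move/(subsetP FS); rewrite mem_inner_edges.
exists S; split=> //.
  by move=> v vS; apply/eqP/(forall_inP degS); rewrite inE.
rewrite -cardF ltnS; apply/subset_leq_card/subsetP=> A AS; apply: contraT => AF.
have [x [y [exy defA]]] : exists x y, e x y /\ A = [set x; y].
  by apply/edgesP; move: AS; rewrite inE => /andP[].
rewrite defA mem_inner_edges exy /= in AS AF; case/andP: AS => xS yS.
have /connectP[q0 xq0 y_last] := conF x y xS yS.
case: (shortenP xq0) y_last => q xq uq _ y_last.
pose c := x :: q.
have cS : {subset c <= S}.
  have all_q : all (mem S) q.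
    by elim: q (x) xq {uq y_last c} => //= v q IHq u /andP[/FP/and3P[_ _ ->] /IHq].
  by move=> u /predU1P[-> // | /(allP all_q)].
have cyc : cycle e c.
  rewrite /c /= rcons_path -y_last e_sym exy andbT.
  by apply: sub_path xq => u v /FP/and3P[].
have c3 : 2 < size c.
  rewrite /c; case: q xq y_last {uq c cS cyc} => [_ yx | v [|//]] /=.
    by rewrite yx e_irr in exy.
  by rewrite andbT => xvF yv; rewrite yv xvF in AF.
have xc : x \in [set u in c] by rewrite !inE eqxx.
have [w [wc _ w2]] := another_degree2 e_sym e_irr x e_min
  (cycle_min_degree2 e_sym uq cyc c3) xc.
rewrite inE in wc.
have covw := cover_setD1_cycle e_sym covS uq cyc c3 cS wc w2.
have /minS : good (S :\ w).
  apply/andP; split=> //; apply/forall_inP=> v; rewrite !inE negb_and negbK.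
  case/predU1P=> [-> | vS]; first by rewrite w2.
  by apply: (forall_inP degS); rewrite inE.
by rewrite (cardsD1 w S) cS // add1n ltnn.
Qed.

Lemma cvc_formula : minimally_two_connected e ->
  2 * #|T| = cvc e + #|edges e| + 1.
Proof.
move=> e_min; have e2 : two_connected e by case/andP: e_min.
have ce : connected_graph e by case/and3P: e2.
have [[S covS cardS] minS] := cvcP ce.
have lower := cover_lower_bound e2 covS; rewrite cardS in lower.
have [S0 [covS0 deg2 treeS0]] := tree_cover e_min.
have upper := minS S0 covS0; apply/eqP; rewrite eqn_leq lower /=.
have /andP[cov0 _] := covS0; rewrite (card_edges_split cov0).
rewrite (eq_bigr (fun=> 2)) => [|y]; last by rewrite inE => /deg2.
rewrite sum_nat_const -(cardsC S0); lia.
Qed.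

End Counting.

Theorem theorem4 (T : finType) (e : rel T)
    (e_sym : symmetric e) (e_irr : irreflexive e)
    (e_min2c : minimally_two_connected e) :
  [/\ ecvc e = cvc e,
      ((cvc e)%:Z = 2 * #|T|%:Z - #|edges e|%:Z - 1)%R
    & forall S : {set T},
        minimum_connected_vertex_cover e S -> eternally_winning e S].
Proof.
split.
- exact: ecvc_eq_cvc.
- have := cvc_formula e_sym e_irr e_min2c; lia.
- by move=> S /andP[covS _]; apply: cover_eternally_winning.
Qed.
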